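(* Let $b\ge 1$ be an integer and let $d = 2b$. Then the even hyperbanana $H^+_{d,b}$ (for any choice of the $\frac d2$ additional edges allowed in its definition) is a Maxwell graph in dimension $d$.
   Context: All graphs are finite and simple. For a graph $G=(V,E)$ and $V'\subseteq V$, $E(V')$ denotes the set of edges in $E$ induced by $V'$ (both endpoints in $V'$). Maxwell graph: a graph $G=(V,E)$ is a Maxwell graph in dimension $d$ if (1) $|E| = d|V| - \binom{d+1}{2}$, and (2) $|E(V')| \le d|V'| - \binom{d+1}{2}$ for all $V'\subseteq V$ with $|V'|\ge d$. Banana bunch: for a positive integer $d$, the banana bunch $B_{d,b}$ is the graph obtained from a complete graph $K_d$ on $d$ vertices by adding $b$ new vertices (the banana vertices), each joined to all $d$ vertices of the $K_d$; there are no edges between banana vertices. Hyperbanana: $H_{d,b}$ is obtained from two copies of $B_{d,b}$ by identifying their banana vertices via a fixed bijection. Explicitly, the vertex set of $H_{d,b}$ is a disjoint union $V = V_1\cup V_2\cup U$ with $|V_1|=|V_2|=d$, $|U|=b$; its edges are all pairs inside $V_1$, all pairs inside $V_2$, and all pairs consisting of one vertex of $U$ and one vertex of $V_1\cup V_2$. Even hyperbanana: for even $d$, $H^+_{d,b}$ is the graph consisting of $H_{d,b}$ together with $\frac d2$ additional edges, each joining a vertex of $V_1$ to a vertex of $V_2$, with pairwise distinct endpoints (i.e. the additional edges form a matching between $V_1$ and $V_2$). *)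

(* Defs.v *)
From mathcomp Require Import all_boot all_order all_algebra.
Set Implicit Arguments. Unset Strict Implicit. Unset Printing Implicit Defensive.

Record sgraph := SGraph {
  vertex :> finType;
  adj : rel vertex;
  adj_sym : symmetric adj;
  adj_irrefl : irreflexive adj
}.

Definition edges (G : sgraph) : {set {set G}} :=
  [set [set p.1; p.2] | p : G * G & adj p.1 p.2].

Definition induced_edges (G : sgraph) (A : {set G}) : {set {set G}} :=
  [set e in edges G | e \subset A].

(* The bounds are integers: on nat, the subtraction would be truncated. *)
Definition maxwell_bound (d n : nat) : int :=
  (d%:Z * n%:Z - 'C(d.+1, 2)%:Z)%R.

Definition maxwell (d : nat) (G : sgraph) : Prop :=
  #|edges G|%:Z%R = maxwell_bound d #|G| /\
  forall A : {set G}, d <= #|A| ->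
    (#|induced_edges A|%:Z <= maxwell_bound d #|A|)%R.

Section Hyperbanana.
Variables d b : nat.

(* The summands are, from left to right, V_1, V_2 and the set U of banana
   vertices shared by the two bunches. *)
Definition hyperbanana_vertex : finType := ('I_d + 'I_d + 'I_b)%type.

Definition hyperbanana_adj : rel hyperbanana_vertex := fun x y =>
  match x, y with
  | inl (inl i), inl (inl j) => i != j
  | inl (inr i), inl (inr j) => i != j
  | inl _, inr _ => true
  | inr _, inl _ => true
  | _, _ => false
  end.

Lemma hyperbanana_sym : symmetric hyperbanana_adj.
Proof. by case=> [[i|i]|i] [[j|j]|j] //=; rewrite eq_sym. Qed.

Lemma hyperbanana_irrefl : irreflexive hyperbanana_adj.
Proof. by case=> [[i|i]|i] //=; rewrite eqxx. Qed.

Definition hyperbanana : sgraph := SGraph hyperbanana_sym hyperbanana_irrefl.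

(* A pair (i, j) in M stands for an edge from the vertex i of V_1 to the
   vertex j of V_2. *)
Definition cross_adj (M : {set 'I_d * 'I_d}) : rel hyperbanana_vertex :=
  fun x y =>
  match x, y with
  | inl (inl i), inl (inr j) => (i, j) \in M
  | inl (inr j), inl (inl i) => (i, j) \in M
  | _, _ => false
  end.

Definition even_hyperbanana_adj (M : {set 'I_d * 'I_d}) :
    rel hyperbanana_vertex :=
  fun x y => adj (x : hyperbanana) y || cross_adj M x y.

Lemma even_hyperbanana_sym M : symmetric (even_hyperbanana_adj M).
Proof.
move=> x y; rewrite /even_hyperbanana_adj adj_sym; congr (_ || _).
by case: x y => [[i|i]|i] [[j|j]|j].
Qed.

Lemma even_hyperbanana_irrefl M : irreflexive (even_hyperbanana_adj M).
Proof. by move=> x; rewrite /even_hyperbanana_adj adj_irrefl; case: x => [[]|]. Qed.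

Definition even_hyperbanana (M : {set 'I_d * 'I_d}) : sgraph :=
  SGraph (even_hyperbanana_sym M) (even_hyperbanana_irrefl M).

End Hyperbanana.

Definition is_matching (d : nat) (M : {set 'I_d * 'I_d}) : Prop :=
  {in M &, injective fst} /\ {in M &, injective snd}.

(* Main.v *)
Require Import Defs.
From mathcomp Require Import all_boot all_order all_algebra.
From mathcomp Require Import zify.

Set Implicit Arguments. Unset Strict Implicit. Unset Printing Implicit Defensive.

(** Let x, y and u be the numbers of vertices of a set A in V_1, V_2 and U, and
    m the number of matching edges inside A. Counting ordered adjacent pairs,
    A induces e edges with
      2 e = x (x - 1) + y (y - 1) + 2 u (x + y) + 2 m,
    by [card_induced_edges]. For the whole vertex set, x = y = d and
    u = m = b = d / 2, and the Maxwell count comes out exactly.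

    For the inequality, the matching gives m <= x, m <= y and m <= b, and the
    rest is arithmetic, [maxwell_count]. Let S be twice the bound minus 2 e,
    for n = x + y + u >= d; S is affine in u, with slope 2 (d - x - y).
    - If x + y <= d, write x + y = d - t, so that u = t + w with w >= 0. Then
        S = 2 (x y - m) + t (t - 1) + 2 w t,
      which is nonnegative since m <= min(x, y) <= x y unless x y = 0, in which
      case m = 0 as well.
    - If x + y > d, write x = d - p, y = d - q and u = b - w. As d = 2 b,
        S = (d - 2 m) + p (d - 1 - p) + q (d - 1 - q) + 2 w (x + y - d),
      where p, q <= d - 1 because p + q < d. This is where the matching having
      only d / 2 edges is used. *)

(** Each edge is the image of exactly two ordered pairs of its endpoints, and
    ordered pairs, unlike two-element sets, split along the three parts of the
    hyperbanana. *)
Lemma sum_adj_induced (G : sgraph) (A : {set G}) :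
  \sum_(v in A) \sum_(w in A) adj v w = 2 * #|induced_edges A|.
Proof.
pose P := [pred p : G * G | [&& p.1 \in A, p.2 \in A & adj p.1 p.2]].
have inP v w : ((v, w) \in P) = [&& v \in A, w \in A & adj v w] by [].
transitivity #|P|.
  rewrite pair_big_dep /= -sum1_card big_mkcond [RHS]big_mkcond.
  by apply: eq_bigr => -[v w] _; rewrite inP andbA; case: (_ && _); case: adj.
rewrite -(sum1_card P) (partition_big (fun p => [set p.1; p.2])
  (fun e => e \in induced_edges A)) /=; last first.
  move=> [v w]; rewrite inP => /and3P[vA wA adjvw].
  rewrite inE subUset !sub1set vA wA !andbT.
  by apply/imsetP; exists (v, w); rewrite ?inE.
rewrite mulnC -sum_nat_const; apply: eq_bigr => e.
rewrite inE => /andP[/imsetP[[x y] + ->]]; rewrite inE /= => adjxy.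
rewrite subUset !sub1set => /andP[xA yA].
have neq_xy : x != y by apply: contraTneq adjxy => ->; rewrite adj_irrefl.
have <- : #|[set (x, y); (y, x)]| = 2 by rewrite cards2 xpair_eqE negb_and neq_xy.
rewrite sum1_card; apply: eq_card => -[u v].
rewrite !inE -[(u, v) \in _]/(_ && _) /= inP !xpair_eqE.
apply/idP/idP.
  case/andP=> /and3P[_ _ adjuv] /eqP eq_e.
  have neq_uv : u != v by apply: contraTneq adjuv => ->; rewrite adj_irrefl.
  have: u \in [set x; y] by rewrite -eq_e set21.
  have: v \in [set x; y] by rewrite -eq_e set22.
  rewrite !inE => /orP[]/eqP eq_v /orP[]/eqP eq_u;
    by move: neq_uv; rewrite eq_u eq_v !eqxx ?orbT.
case/orP=> /andP[/eqP-> /eqP->]; first by rewrite xA yA adjxy eqxx.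
by rewrite xA yA adj_sym adjxy /= setUC.
Qed.

Lemma sum_clique (T : finType) (B : {set T}) (e : rel T) :
  (forall i j, e i j = (i != j)) ->
  \sum_(i in B) \sum_(j in B) e i j + #|B| = #|B| * #|B|.
Proof.
move=> eE; rewrite -[in LHS]sum1_card -big_split /= -sum_nat_const.
apply: eq_bigr => i iB; rewrite (bigD1 i iB) /= eE eqxx add0n.
rewrite -[RHS]sum1_card [RHS](bigD1 i iB) /= addnC; congr (_ + _).
by apply: eq_bigr => j /andP[_]; rewrite eE eq_sym => ->.
Qed.

Section Traces.
Variables (d b : nat) (M : {set 'I_d * 'I_d}).
Implicit Type A : {set even_hyperbanana b M}.

Definition trace1 A : {set 'I_d} := [set i | inl (inl i) \in A].
Definition trace2 A : {set 'I_d} := [set j | inl (inr j) \in A].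
Definition traceU A : {set 'I_b} := [set k | inr k \in A].
Definition traceM A : {set 'I_d * 'I_d} :=
  [set p in M | (p.1 \in trace1 A) && (p.2 \in trace2 A)].

Lemma sum_hyperbanana_vertex A (F : even_hyperbanana b M -> nat) :
  \sum_(v in A) F v = \sum_(i in trace1 A) F (inl (inl i))
    + \sum_(j in trace2 A) F (inl (inr j)) + \sum_(k in traceU A) F (inr k).
Proof.
rewrite big_mkcond big_sumType big_sumType /= -!big_mkcond /=.
by congr (_ + _ + _); apply: eq_bigl => i; rewrite inE.
Qed.

Lemma card_traces A : #|A| = #|trace1 A| + #|trace2 A| + #|traceU A|.
Proof. by rewrite -!sum1_card sum_hyperbanana_vertex. Qed.

Lemma sum_traceM A :
  \sum_(i in trace1 A) \sum_(j in trace2 A) ((i, j) \in M) = #|traceM A|.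
Proof.
rewrite pair_big_dep /= -sum1_card big_mkcond [RHS]big_mkcond.
by apply: eq_bigr => -[i j] _; rewrite !inE /=; case: (_ \in M); case: ifP.
Qed.

(** The summand x + y on the left moves the negative terms of x (x - 1) and
    y (y - 1) across, so that no truncated subtraction occurs. *)
Lemma card_induced_edges A :
  2 * #|induced_edges A| + #|trace1 A| + #|trace2 A| =
    #|trace1 A| ^ 2 + #|trace2 A| ^ 2
      + 2 * #|traceU A| * (#|trace1 A| + #|trace2 A|) + 2 * #|traceM A|.
Proof.
(* One sum for each ordered pair of parts; matching edges occur once in each
   direction. *)
rewrite -sum_adj_induced sum_hyperbanana_vertex.
under [X in X + _ + _ + _ + _ = _]eq_bigr do
  rewrite sum_hyperbanana_vertex /even_hyperbanana_adj /=.
under [X in _ + X + _ + _ + _ = _]eq_bigr do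
  rewrite sum_hyperbanana_vertex /even_hyperbanana_adj /=.
under [X in _ + X + _ + _ = _]eq_bigr do
  rewrite sum_hyperbanana_vertex /even_hyperbanana_adj /=.
rewrite !big_split /=.
rewrite [\sum_(j in trace2 A) \sum_(i in trace1 A) _]exchange_big /=.
rewrite !sum_traceM.
have := @sum_clique _ (trace1 A) (fun i j =>
  even_hyperbanana_adj (b:=b) M (inl (inl i)) (inl (inl j))) (fun i j => orbF _).
have := @sum_clique _ (trace2 A) (fun i j =>
  even_hyperbanana_adj (b:=b) M (inl (inr i)) (inl (inr j))) (fun i j => orbF _).
rewrite !sum_nat_const ?muln1 ?muln0 => clique2 clique1.
move: clique1 clique2; rewrite -!mulnn.
move: (\sum_(i in trace1 A) _) (\sum_(i in trace2 A) _) => s1 s2.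
move: #|trace1 A| #|trace2 A| #|traceU A| #|traceM A| => x y u m.
by lia.
Qed.

(** A matching projects injectively to either side. *)
Lemma card_traceM A : is_matching M ->
  [/\ #|traceM A| <= #|M|, #|traceM A| <= #|trace1 A|
    & #|traceM A| <= #|trace2 A|].
Proof.
have sub_M : traceM A \subset M by apply/subsetP => p; rewrite inE => /andP[].
case=> inj_fst inj_snd; split; first exact: subset_leq_card.
- rewrite -(card_in_imset (sub_in2 (subsetP sub_M) inj_fst)).
  by apply/subset_leq_card/subsetP => _ /imsetP[p + ->]; rewrite inE => /and3P[].
rewrite -(card_in_imset (sub_in2 (subsetP sub_M) inj_snd)).
by apply/subset_leq_card/subsetP => _ /imsetP[p + ->]; rewrite inE => /and3P[].
Qed.

End Traces.

(** The binomial coefficient is half of d (d + 1), so after doubling a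
    comparison with the Maxwell bound no longer needs integers. *)
Lemma maxwell_bound_le d n e :
  (e%:Z <= maxwell_bound d n)%R = (2 * e + d * (d + 1) <= 2 * d * n).
Proof.
have := mul_bin_diag d.+1 1; rewrite bin1 /= /maxwell_bound => bin2d.
by apply/idP/idP; lia.
Qed.

Lemma maxwell_bound_eq d n e :
  2 * e + d * (d + 1) = 2 * d * n -> e%:Z%R = maxwell_bound d n.
Proof.
by have := mul_bin_diag d.+1 1; rewrite bin1 /= /maxwell_bound; lia.
Qed.

(** Adding x + y to the right-hand side cancels the same sum in
    [card_induced_edges]; the inequality says that twice the Maxwell bound is
    at least twice the number of edges. *)
Lemma maxwell_count b d x y u m : d = 2 * b ->
  x <= d -> y <= d -> u <= b -> m <= b -> m <= x -> m <= y ->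
  d <= x + y + u ->
  x ^ 2 + y ^ 2 + 2 * u * (x + y) + 2 * m + d * (d + 1)
    <= 2 * d * (x + y + u) + x + y.
Proof.
move=> hd xd yd ub mb mx my big.
rewrite -!mulnn.
have [le_xyd | lt_dxy] := leqP (x + y) d.
  have [t def_d] : exists t, d = x + y + t by exists (d - (x + y)); lia.
  have [w def_u] : exists w, u = t + w by exists (u - t); lia.
  have le_mxy : m <= x * y.
    by case: (posnP y) => [y0|y0]; [lia | exact: leq_trans mx (leq_pmulr _ y0)].
  have le_tt : t <= t * t by case: (t) => // s; exact: leq_pmulr.
  by rewrite {}def_u {}def_d; lia.
(* Through d = p + q + k + 1 every slack term p (d - 1 - p), q (d - 1 - q) and
   w (x + y - d) becomes a polynomial with nonnegative coefficients. *)
pose k := x + y - d.+1; pose p := d - x; pose q := d - y.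
have [def_x def_y def_d] : [/\ x = q + k + 1, y = p + k + 1 & d = p + q + k + 1].
  by split; lia.
have [w def_b] : exists w, b = u + w by exists (b - u); lia.
have u_xy : 2 * u * (x + y) + 2 * w * (x + y) = d * (x + y).
  by rewrite -mulnDl -mulnDr -def_b -hd.
have u_d : 2 * d * u + 2 * d * w = d * d.
  by rewrite -mulnDr -def_b hd; lia.
have le_md : 2 * m <= d by lia.
clear - u_xy u_d le_md def_x def_y def_d.
by clearbody k p q; subst x y d; lia.
Qed.

Theorem theorem12 (b d : nat) (hb : 1 <= b) (hd : d = 2 * b)
    (M : {set 'I_d * 'I_d}) (hM : is_matching M) (hcard : #|M| = d./2) :
  maxwell d (even_hyperbanana b M).
Proof.
have {}hcard : #|M| = b by rewrite hcard hd mul2n doubleK.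
split=> [|A le_dA].
  pose V := [set: even_hyperbanana b M].
  have -> : edges (even_hyperbanana b M) = induced_edges V.
    by apply/setP => e; rewrite [RHS]inE subsetT andbT.
  have tr1 : trace1 V = setT by apply/setP=> i; rewrite !inE.
  have tr2 : trace2 V = setT by apply/setP=> i; rewrite !inE.
  have trU : traceU V = setT by apply/setP=> i; rewrite !inE.
  have trM : traceM V = M by apply/setP=> p; rewrite !inE !andbT.
  have cardV := card_traces V; have cardE := card_induced_edges V.
  rewrite tr1 tr2 trU trM !cardsT !card_ord hcard -?mulnn in cardV cardE.
  apply: maxwell_bound_eq; rewrite cardV.
  have dd : d * d = 2 * (d * b) by rewrite {2}hd; lia.
  lia.
have [mM m1 m2] := card_traceM A hM; rewrite hcard in mM.
have xd : #|trace1 A| <= d by rewrite -[leqRHS]card_ord max_card.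
have yd : #|trace2 A| <= d by rewrite -[leqRHS]card_ord max_card.
have ub : #|traceU A| <= b by rewrite -[leqRHS]card_ord max_card.
rewrite maxwell_bound_le card_traces; rewrite card_traces in le_dA.
have := maxwell_count hd xd yd ub mM m1 m2 le_dA.
by have := card_induced_edges A; lia.
Qed.
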